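(* Let $n\ge 1$, and let $T^{(1)},T^{(2)},\ldots,T^{(N)}$ be any linear extension of the weak order $(\mathrm{MT}_n,<_W)$ on monotone triangles of size $n$ (i.e. a total ordering of all the elements of $\mathrm{MT}_n$ such that $T^{(i)}<_W T^{(j)}$ implies $i<j$). Then the corresponding ordering of the facets $\{T^{(i)}_1,\ldots,T^{(i)}_{n-1}\}$, $i=1,\ldots,N$, of the order complex $\Delta(\Phi_n\setminus\{\varnothing,[n]\})$ is a shelling order.
   Context: Notation: $[n]=\{1,\ldots,n\}$. If $I=\{i_1<\cdots<i_m\}$ and $J=\{j_1<\cdots<j_{m+1}\}$ are subsets of $[n]$, say $J$ interlaces $I$ if $j_1\le i_1\le j_2\le i_2\le\cdots\le j_m\le i_m\le j_{m+1}$. A monotone triangle of size $n$ is a sequence $T=(T_0,T_1,\ldots,T_n)$ of subsets of $[n]$ with $\#T_m=m$ and $T_{m+1}$ interlacing $T_m$ for $0\le m<n$ (so $T_0=\varnothing$, $T_n=[n]$); $\mathrm{MT}_n$ is the set of all of these. $\Phi_n$ is the partial order on all subsets of $[n]$ that is the (reflexive) transitive closure of the relations $I<J$ where $\#J=\#I+1$ and $J$ interlaces $I$. Its bottom element is $\varnothing$, its top element is $[n]$, and its maximal chains are exactly the monotone triangles of size $n$. The order complex $\Delta(\Phi_n\setminus\{\varnothing,[n]\})$ is the abstract simplicial complex with vertex set $\Phi_n\setminus\{\varnothing,[n]\}$ whose simplices are the totally ordered subsets; its facets correspond to the monotone triangles $T$ via $T\mapsto\{T_1,\ldots,T_{n-1}\}$.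 For a monotone triangle $T$ and $1\le i\le n-1$, with $T_{i-1}=\{a_1<\cdots<a_{i-1}\}$ and $T_{i+1}=\{b_1<\cdots<b_{i+1}\}$, let $H_{\min}(T_{i-1},T_{i+1})=\{h_1<\cdots<h_i\}$ with $h_m=\max(a_{m-1},b_m)$, where $a_0:=0$. Define $T\times\pi_i$ to be the monotone triangle obtained from $T$ by replacing its row $T_i$ with $H_{\min}(T_{i-1},T_{i+1})$. The weak order $\le_W$ on $\mathrm{MT}_n$ is the reflexive transitive closure of the relations $T\times\pi_i\le_W T$ for $T\in\mathrm{MT}_n$, $1\le i\le n-1$. Shelling: for a simplicial complex all of whose facets have the same cardinality, an ordering $F_1,F_2,\ldots,F_N$ of its facets is a shelling order if for every pair $i<j$ there exists $k<j$ with $F_i\cap F_j\subseteq F_k\cap F_j$ and $\#(F_k\cap F_j)=\#F_j-1$. *)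

(* Defs.v *)
From HB Require Import structures.
From mathcomp Require Import zify.
From mathcomp Require Import all_boot.

Set Implicit Arguments.
Unset Strict Implicit.
Unset Printing Implicit Defensive.

Section OrderAndComplexes.

Variable V : finType.
Implicit Types (le lt : rel V) (A F : {set V}) (K : {set {set V}}).

Definition linear_extension lt (s : seq V) : Prop :=
  perm_eq s (enum V) /\ forall x y : V, lt x y -> index x s < index y s.

(* The empty simplex is included. *)
Definition order_complex le A : {set {set V}} :=
  [set F : {set V} | (F \subset A) &&
     [forall x in F, forall y in F, le x y || le y x]].

Definition facets K : {set {set V}} := [set F | maxset (fun G => G \in K) F].

Definition pure K : Prop :=
  forall F G : {set V}, F \in facets K -> G \in facets K -> #|F| = #|G|.

Definition shelling_order K (s : seq {set V}) : Prop :=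
  [/\ pure K,
      perm_eq s (enum (facets K))
    & forall i j : nat, i < j -> j < size s ->
      exists k : nat,
        [/\ k < j,
            nth set0 s i :&: nth set0 s j \subset nth set0 s k :&: nth set0 s j
          & #|nth set0 s k :&: nth set0 s j|.+1 = #|nth set0 s j| ] ].

End OrderAndComplexes.

(* The element x : 'I_n stands for the integer x.+1 of [n] = {1, ..., n}.     *)
(* If I = {i_1 < ... < i_m} then elt I k = i_k for 1 <= k <= m, elt I 0 = 0   *)
(* (the convention a_0 := 0), and elt I k is the junk value 0 for k > m.      *)
(* This relies on enum I being increasing, see elt_ltn.                       *)
Definition elt n (I : {set 'I_n}) (k : nat) : nat :=
  nth 0 (0 :: [seq (val x).+1 | x <- enum I]) k.

(* J interlaces I *)
Definition interlaces n (J I : {set 'I_n}) : bool :=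
  (#|J| == #|I|.+1) &&
  [forall k : 'I_#|I|, elt J k.+1 <= elt I k.+1 <= elt J k.+2].

Definition phi_le n : rel {set 'I_n} :=
  connect (fun I J : {set 'I_n} => interlaces J I).

Definition phi_proper n : {set {set 'I_n}} := ~: [set set0; setT].

Definition mrow n (T : {ffun 'I_n.+1 -> {set 'I_n}}) (m : nat) : {set 'I_n} :=
  T (inord m).

Definition is_mt n (T : {ffun 'I_n.+1 -> {set 'I_n}}) : bool :=
  [forall m : 'I_n.+1, #|mrow T m| == m] &&
  [forall m : 'I_n, interlaces (mrow T m.+1) (mrow T m)].

Record MT n := MkMT {
  mt_rows :> {ffun 'I_n.+1 -> {set 'I_n}};
  mt_rowsP : is_mt mt_rows }.

HB.instance Definition _ n := [isSub for @mt_rows n].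
HB.instance Definition _ n := [Finite of MT n by <:].

(* With A = {a_1 < ... < a_(i-1)} and B = {b_1 < ... < b_(i+1)}, the index    *)
(* m : 'I_#|A|.+1 produces h_(m+1) = max(a_m, b_(m+1)).                       *)
Definition hmin n (A B : {set 'I_n}) : {set 'I_n} :=
  [set x : 'I_n | [exists m : 'I_#|A|.+1,
     x.+1 == maxn (elt A m) (elt B m.+1)]].

(* T x pi_i, meaningful for 0 < i < n; is_mt_times_pi shows that it is then a *)
(* monotone triangle.                                                         *)
Definition times_pi n (T : {ffun 'I_n.+1 -> {set 'I_n}}) (i : nat) :
    {ffun 'I_n.+1 -> {set 'I_n}} :=
  [ffun m : 'I_n.+1 => if m == i :> nat then hmin (mrow T i.-1) (mrow T i.+1)
                       else T m].

Definition weak_le n : rel (MT n) :=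
  connect (fun S T : MT n =>
    [exists i : 'I_n, (0 < i) && (mt_rows S == times_pi T i)]).

Definition weak_lt n : rel (MT n) := fun S T => (S != T) && weak_le S T.

Definition mt_facet n (T : MT n) : {set {set 'I_n}} :=
  [set mrow T m | m : 'I_n.+1 & 0 < m < n].

Section ElementLists.

Variable n : nat.
Implicit Types (I J A B C : {set 'I_n}).

Let labels I := [seq (val x).+1 | x <- enum I].

Let size_labels I : size (labels I) = #|I|.
Proof. by rewrite size_map cardE. Qed.

Let sorted_labels I : sorted ltn (labels I).
Proof.
rewrite /labels sorted_map.
have : sorted ltn (map val (enum I)).
  rewrite {1}/enum_mem -enumT.
  have /= := @sorted_filter _ (relpre val ltn) _ (mem I) (enum 'I_n).
  rewrite sorted_map; apply; first by move=> x y z /=; apply: ltn_trans.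
  by rewrite -sorted_map val_enum_ord iota_ltn_sorted.
by rewrite sorted_map; apply: sub_sorted.
Qed.

Lemma elt_ltn I k l : k < l -> l <= #|I| -> elt I k < elt I l.
Proof.
move=> kl lI; rewrite /elt -/(labels I).
have s0 : sorted ltn (0 :: labels I).
  rewrite /= path_sortedE ?sorted_labels ?andbT; last exact: ltn_trans.
  by apply/allP => _ /mapP[x _ ->].
apply: (sorted_ltn_nth ltn_trans 0 s0) => //; rewrite !inE /= size_labels; lia.
Qed.

Lemma elt_bound I k : elt I k <= n.
Proof.
rewrite /elt; case: k => [|k] //=.
case: (ltnP k (size (labels I))) => kI; last by rewrite nth_default.
by have /mapP[x _ ->] := mem_nth 0 kI; apply: ltn_ord.
Qed.

Lemma elt_image (f : nat -> nat) p (S : {set 'I_n}) :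
    (forall k l, k < l -> l < p -> f k < f l) ->
    (forall k, k < p -> 0 < f k <= n) ->
    S = [set x : 'I_n | [exists m : 'I_p, x.+1 == f m]] ->
  #|S| = p /\ forall k, k < p -> elt S k.+1 = f k.
Proof.
move=> fM fB defS.
have eqS : labels S = map f (iota 0 p).
  apply: (irr_sorted_eq ltn_trans ltnn); rewrite ?sorted_labels //.
    rewrite sorted_map.
    apply/(sortedP 0) => i; rewrite size_iota => ip /=.
    by rewrite !nth_iota ?add0n ?fM //; lia.
  move=> y; apply/mapP/mapP => [[x] | [k]].
    rewrite mem_enum defS inE => /existsP[m /eqP e] ->.
    by exists (val m); rewrite /= ?mem_iota ?ltn_ord ?e.
  rewrite mem_iota add0n => /= kp ->; have /andP[f0 fn] := fB k kp.
  have hx : (f k).-1 < n by lia.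
  exists (Ordinal hx); last by rewrite /=; lia.
  by rewrite mem_enum defS inE; apply/existsP; exists (Ordinal kp) => /=; lia.
split; first by rewrite -size_labels eqS size_map size_iota.
by move=> k kp; rewrite /elt -/(labels S) eqS /= (nth_map 0) ?size_iota // nth_iota.
Qed.

Lemma interlacesP J I :
  reflect (#|J| = #|I|.+1 /\
           forall k, k < #|I| -> elt J k.+1 <= elt I k.+1 <= elt J k.+2)
          (interlaces J I).
Proof.
apply: (iffP andP) => [[/eqP cJ /forallP H] | [cJ H]]; split=> //.
- by move=> k kI; apply: (H (Ordinal kI)).
- exact/eqP.
- by apply/forallP => k; apply: H.
Qed.

Lemma hmin_interlaces A B C : interlaces C A -> interlaces B C ->
  interlaces (hmin A B) A /\ interlaces B (hmin A B).
Proof.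
move=> /interlacesP[cC CA] /interlacesP[cB BC].
have aB k : k <= #|A| -> elt A k <= elt B k.+2.
  case: k => [|k] kA; first by [].
  have /andP[_ h1] := CA k kA.
  have hk : k.+1 < #|C| by lia.
  by have /andP[_] := BC _ hk; lia.
have bA k : k < #|A| -> elt B k.+1 <= elt A k.+1.
  move=> kA; have /andP[h1 _] := CA k kA.
  have hk : k < #|C| by lia.
  by have /andP[+ _] := BC _ hk; lia.
have [] := @elt_image (fun m => maxn (elt A m) (elt B m.+1)) #|A|.+1 (hmin A B).
- move=> k l kl lA.
  have h1 : elt A k < elt A l by apply: elt_ltn; lia.
  have h2 : elt B k.+1 < elt B l.+1 by apply: elt_ltn; lia.
  lia.
- move=> k kA; have h1 : elt B 0 < elt B k.+1 by apply: elt_ltn; lia.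
  by have := elt_bound A k; have := elt_bound B k.+1; lia.
- by [].
move=> cH eH; split; apply/interlacesP; split; rewrite ?cH ?cB ?cC //.
- move=> k kA; rewrite !eH; try lia.
  have h1 : elt A k < elt A k.+1 by apply: elt_ltn; lia.
  by have := bA k kA; lia.
- move=> k kA; rewrite !eH //.
  have h1 : elt B k.+1 < elt B k.+2 by apply: elt_ltn; lia.
  by have := aB k kA; lia.
Qed.

End ElementLists.

Lemma is_mt_times_pi n (T : {ffun 'I_n.+1 -> {set 'I_n}}) (i : nat) :
  0 < i < n -> is_mt T -> is_mt (times_pi T i).
Proof.
move=> /andP[i0 iN] /andP[/forallP cT /forallP iT].
have rT m : m <= n -> mrow (times_pi T i) m =
    if m == i then hmin (mrow T i.-1) (mrow T i.+1) else mrow T m.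
  by move=> mn; rewrite /mrow ffunE inordK.
have iT' m : m < n -> interlaces (mrow T m.+1) (mrow T m).
  by move=> mn; apply: (iT (Ordinal mn)).
have [hA hB] : interlaces (hmin (mrow T i.-1) (mrow T i.+1)) (mrow T i.-1) /\
    interlaces (mrow T i.+1) (hmin (mrow T i.-1) (mrow T i.+1)).
  apply: (@hmin_interlaces _ _ _ (mrow T i)); last exact: iT'.
  by have := iT' i.-1; rewrite prednK //; apply; lia.
apply/andP; split; apply/forallP => m.
  rewrite (rT m (ltn_ord m)); case: (nat_of_ord m =P i) => [->|_]; last exact: cT.
  have hi : i.-1 < n.+1 by lia.
  have /eqP c := cT (Ordinal hi); move: c => /= c.
  by case/interlacesP: hA => -> _; rewrite c prednK.
rewrite !rT; [|exact: ltnW|exact: ltn_ord].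
case: (m.+1 =P i) => [e|_]; case: (nat_of_ord m =P i) => [e'|_]; try lia.
- by have -> : nat_of_ord m = i.-1 by lia.
- by rewrite e'.
- exact: iT'.
Qed.

(* Main.v *)
Require Import Defs.
From mathcomp Require Import zify.
From mathcomp Require Import all_boot.

(** Call a row i with 0 < i < n of a monotone triangle T movable if
    T x pi_i <> T.  If row i is movable then T x pi_i is a facet that comes
    before T in every linear extension of the weak order, and it meets T in
    all of T except the row T_i (times_pi_facetI).  So it is enough to find,
    whenever S comes before T, a movable row i of T with S_i <> T_i: then S
    and T share no more than T x pi_i and T do.

    Such a row exists unless T <=_W S (exists_movable_row), and T <=_W S is
    excluded because S comes first.  Indeed, suppose that no row in which S
    and T differ is movable in T.  In such a row, each entry t_(i,m) equals
    t_(i-1,m-1) or t_(i+1,m).  Starting from such an entry and following these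
    equalities, one can never turn, because the two entries on either side of
    a turn would be distinct entries of one row.  The walk therefore goes
    straight until it meets a row that S and T share, and there the weak
    inequalities between consecutive rows of S show that t_(i,m) is at most
    the corresponding entry of S (row_leq).  Hence T is entrywise below every
    S like this, and is the only such triangle with no movable row among those
    where it differs from T (fixed_eq).  Now push S down by operators pi_i in
    the rows where it differs from T: the entries decrease, so this stops,
    and by uniqueness it stops at T (fixed_weak_le).

    It remains to identify the facets of the complex with the monotone
    triangles.  Adding a single element to a set always produces an
    interlacing set (interlacesU1), so the empty set and the full set are the
    extremes of the poset, and any chain of proper sets refines to a chain of
    cover relations from one extreme to the other.  Each cover adds one to the
    cardinality, which makes that chain a monotone triangle
    (chain_sub_mt_facet). *)

Set Implicit Arguments.
Unset Strict Implicit.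
Unset Printing Implicit Defensive.

(** * Entries of a set *)

Section Entries.

Variable n : nat.
Implicit Types (I J : {set 'I_n}).

Lemma sorted_nth_leq (s : seq nat) v k : sorted ltn s -> k < size s ->
  (nth 0 s k <= v) = (k < count (leq^~ v) s).
Proof.
elim: s k => [|a s IHs] k //= ps ks.
have count0 : v < a -> count (leq^~ v) s = 0.
  move=> va; apply/eqP; rewrite -[_ == 0]negbK -lt0n -has_count -all_predC.
  by have := order_path_min ltn_trans ps; apply: sub_all => x /=; lia.
case: k ks => [|k] ks /=; case: (leqP a v) => va //; first by rewrite count0.
  by rewrite (IHs k (path_sorted ps)) // add1n ltnS.
by rewrite (IHs k (path_sorted ps)) // count0.
Qed.

(** Comparing entries with a bound is the same as counting the elements below
    that bound, which is how interlacing is checked for a set with an element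
    added. *)
Lemma elt_leq I v k : k < #|I| ->
  (elt I k.+1 <= v) = (k < #|[set x in I | x < v]|).
Proof.
move=> kI; rewrite /elt /= sorted_nth_leq.
- rewrite count_map cardE -size_filter; congr (_ < size _).
  rewrite /enum_mem -filter_predI; apply: eq_filter => x /=.
  by rewrite inE andbC.
- apply/(sortedP 0) => i; rewrite size_map -cardE => iI.
  by have := @elt_ltn n I i.+1 i.+2 (ltnSn _) iI.
- by rewrite size_map -cardE.
Qed.

Lemma mem_elt I (x : 'I_n) :
  reflect (exists2 k, k < #|I| & x.+1 = elt I k.+1) (x \in I).
Proof.
apply: (iffP idP) => [xI | [k kI]].
  exists (index x (enum I)); first by rewrite cardE index_mem mem_enum.
  by rewrite /elt /= (nth_map x) ?nth_index ?index_mem ?mem_enum.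
rewrite /elt /= (nth_map x) -?cardE // => -[/val_inj ->].
by rewrite -mem_enum mem_nth // -cardE.
Qed.

Lemma elt_inj I J : #|I| = #|J| ->
  (forall k, k < #|I| -> elt I k.+1 = elt J k.+1) -> I = J.
Proof.
move=> cIJ eIJ; apply/setP => x; apply/mem_elt/mem_elt => -[k kI ->].
  by exists k; rewrite -?cIJ ?eIJ.
by exists k; rewrite ?cIJ // eIJ ?cIJ.
Qed.

(** Below any bound, x |: I has as many elements as I, or one more. *)
Lemma interlacesU1 I x : x \notin I -> interlaces (x |: I) I.
Proof.
move=> xI; have cU : #|x |: I| = #|I|.+1 by rewrite cardsU1 xI.
have cntU v : #|[set y in x |: I | y < v]| = (x < v) + #|[set y in I | y < v]|.
  case: (ltnP x v) => xv.
    have -> : [set y in x |: I | y < v] = x |: [set y in I | y < v].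
      by apply/setP => y; rewrite !inE; case: eqP => [->|//]; rewrite xv.
    by rewrite cardsU1 inE (negbTE xI).
  congr #|pred_of_set _|; apply/setP => y; rewrite !inE.
  by case: eqP => [->|//]; rewrite ltnNge xv !andbF.
apply/interlacesP; split=> // k kI; apply/andP; split.
  rewrite elt_leq ?cU ?cntU; last lia.
  have := leqnn (elt I k.+1); rewrite elt_leq //; lia.
rewrite elt_leq //.
have := leqnn (elt (x |: I) k.+2); rewrite elt_leq ?cU // cntU.
by case: (x < _); lia.
Qed.

End Entries.

(** * Facets of the order complex *)

Section Poset.

Variable n : nat.
Implicit Types (I J : {set 'I_n}).

Lemma phi_le_sub I J : I \subset J -> phi_le I J.
Proof.
have [m] := ubnP #|J :\: I|; elim: m I => // m IHm I cm IJ.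
have [/eqP|/set0Pn[x]] := eqVneq (J :\: I) set0.
  rewrite setD_eq0 => JI; suff -> : I = J by apply: connect0.
  by apply/eqP; rewrite eqEsubset IJ.
move=> xJI; have := xJI; rewrite inE => /andP[xI xJ].
apply: (@connect_trans _ _ (x |: I)); first exact/connect1/interlacesU1.
apply: IHm.
  have -> : J :\: (x |: I) = (J :\: I) :\ x by rewrite setUC -setDDl.
  by move: cm; rewrite (cardsD1 x) xJI.
by rewrite subUset sub1set xJ.
Qed.

Lemma path_card I p : path (fun I J => interlaces J I) I p ->
  forall k, k <= size p -> #|nth I (I :: p) k| = #|I| + k.
Proof.
elim: p I => [|J p IHp] I /=; first by move=> _ [|//] _; rewrite addn0.
move=> /andP[/interlacesP[cJ _] pp] [|k] kp; first by rewrite addn0.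
rewrite /= -(addSnnS _ k) -cJ -(IHp J pp k kp).
by case: k kp => [|k] kp //=; congr #|pred_of_set _|; apply: set_nth_default.
Qed.

Lemma mt_card (T : MT n) m : m <= n -> #|mrow T m| = m.
Proof.
move=> mn; have /andP[/forallP H _] := mt_rowsP T.
by apply/eqP; apply: (H (Ordinal (mn : m < n.+1))).
Qed.

Lemma mt_interlaces (T : MT n) m : m < n -> interlaces (mrow T m.+1) (mrow T m).
Proof.
by move=> mn; have /andP[_ /forallP H] := mt_rowsP T; apply: (H (Ordinal mn)).
Qed.

Lemma mt_bottom (T : MT n) : mrow T 0 = set0.
Proof. by apply/eqP; rewrite -cards_eq0 mt_card. Qed.

Lemma mt_top (T : MT n) : mrow T n = setT.
Proof. by apply/eqP; rewrite eqEcard subsetT cardsT card_ord mt_card /=. Qed.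

Lemma mt_phi_le (T : MT n) i j : i <= j -> j <= n -> phi_le (mrow T i) (mrow T j).
Proof.
elim: j => [|j IHj] ij jn; first by move: ij; rewrite leqn0 => /eqP->; apply: connect0.
case: (ltngtP i j.+1) ij => // [ij _|-> _]; last exact: connect0.
apply: connect_trans (IHj _ _) _; [lia|lia|].
exact/connect1/mt_interlaces.
Qed.

Lemma mt_eqP (S T : MT n) :
  (forall m, 0 < m < n -> mrow S m = mrow T m) -> S = T.
Proof.
move=> eST; apply/val_inj/ffunP => m /=.
have mrowE (R : MT n) : R m = mrow R m by rewrite /mrow inord_val.
rewrite !mrowE; have := ltn_ord m; rewrite ltnS => mn.
case: (posnP m) => [->|m_gt0]; first by rewrite !mt_bottom.
case: (ltngtP m n) mn => // [mn _|-> _]; last by rewrite !mt_top.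
by apply: eST; rewrite m_gt0.
Qed.

Lemma mt_facetP (T : MT n) I :
  reflect (exists2 m, 0 < m < n & I = mrow T m) (I \in mt_facet T).
Proof.
apply: (iffP imsetP) => [[m + ->] | [m mn ->]]; first by rewrite inE; exists m.
have mn' : m < n.+1 by lia.
by exists (Ordinal mn'); rewrite ?inE.
Qed.

(** The rows of a monotone triangle are indexed by their cardinality, so a
    set can occur in it in one place only. *)
Lemma mem_mt_facet (T : MT n) I :
  (I \in mt_facet T) = (0 < #|I| < n) && (I == mrow T #|I|).
Proof.
apply/mt_facetP/andP => [[m mn ->]|[In /eqP eI]]; last by exists #|I|.
by rewrite mt_card ?mn; [split | lia].
Qed.

Lemma mem_phi_proper I : (I \in phi_proper n) = (0 < #|I| < n).
Proof.
rewrite !inE negb_or -cards_eq0 -lt0n; congr (_ && _).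
have := subset_leq_card (subsetT I); rewrite cardsT card_ord => In.
by rewrite eqEcard subsetT cardsT card_ord /= -ltnNge.
Qed.

Lemma card_mt_facet (T : MT n) :
  #|mt_facet T| = #|[set m : 'I_n.+1 | 0 < m < n]|.
Proof.
rewrite card_in_imset //.
move=> i j _ _ /(congr1 (fun I : {set _} => #|I|)).
by rewrite !mt_card -1?ltnS // => /val_inj.
Qed.

Lemma mt_facet_inj : injective (@mt_facet n).
Proof.
move=> S T eST; apply: mt_eqP => m mn.
have : mrow S m \in mt_facet T by rewrite -eST; apply/mt_facetP; exists m.
have mn' : m <= n by lia.
by rewrite mem_mt_facet mt_card // => /andP[_ /eqP].
Qed.

Local Notation K := (order_complex (@phi_le n) (phi_proper n)).

Lemma mt_facet_chain (T : MT n) : mt_facet T \in K.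
Proof.
rewrite inE; apply/andP; split.
  by apply/subsetP => I; rewrite mem_mt_facet mem_phi_proper => /andP[].
apply/forall_inP => _ /mt_facetP[i iN ->]; apply/forall_inP => _ /mt_facetP[j jN ->].
case: (leqP i j) => ij; first by rewrite mt_phi_le //; lia.
by rewrite orbC mt_phi_le //; lia.
Qed.

Lemma phi_path_refine I p : path (@phi_le n) I p ->
  exists2 q, path (fun A B => interlaces B A) I q &
    {subset p <= I :: q} /\ last I q = last I p.
Proof.
elim: p I => [|J p IHp] I /=; first by exists [::].
move=> /andP[/connectP[q1 pq1 ->] /IHp[q2 pq2 [sub2 last2]]].
exists (q1 ++ q2); first by rewrite cat_path pq1.
rewrite last_cat; split=> // x; rewrite inE -cat_cons mem_cat.
case/predU1P => [->|/sub2]; first by rewrite mem_last.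
by rewrite inE => /predU1P[->|->]; rewrite ?mem_last ?orbT.
Qed.

Lemma cover_path_mt p : path (fun A B => interlaces B A) (@set0 'I_n) p ->
  last set0 p = setT ->
  exists T : MT n, {in p, forall I, I = mrow T #|I|}.
Proof.
move=> pp lp; have szp : size p = n.
  by have := path_card pp (leqnn _); rewrite -last_nth lp cardsT card_ord cards0.
pose f : {ffun 'I_n.+1 -> {set 'I_n}} := [ffun m : 'I_n.+1 => nth set0 (set0 :: p) m].
have fE m : m <= n -> mrow f m = nth set0 (set0 :: p) m.
  by move=> mn; rewrite /mrow ffunE inordK.
have f_mt : is_mt f.
  apply/andP; split; apply/forallP => m.
    have mn : m <= n by rewrite -ltnS.
    by rewrite fE // (path_card pp) ?szp // cards0.
  rewrite !fE //; last exact: ltnW.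
  by move/(pathP set0): pp; apply; rewrite szp.
exists (MkMT f_mt) => I Ip.
have ip : index I p < n by move: Ip; rewrite -index_mem szp.
have eI : I = nth set0 (set0 :: p) (index I p).+1 by rewrite /= nth_index.
have cI : #|I| = (index I p).+1 by rewrite {1}eI (path_card pp) ?szp // cards0.
by rewrite fE cI.
Qed.

(** A chain of proper sets can be sorted and bordered by the empty and the
    full set; refining each comparison into covers gives the triangle. *)
Lemma chain_sub_mt_facet (F : {set {set 'I_n}}) :
  F \in K -> exists T : MT n, F \subset mt_facet T.
Proof.
rewrite inE => /andP[/subsetP FP /forall_inP chF].
pose c := sort (@phi_le n) (enum F).
have sc : sorted (@phi_le n) c.
  apply: (sort_sorted_in (P := mem F)); last by apply/allP => I; rewrite mem_enum.
  by move=> I J IF; move/forall_inP: (chF I IF); apply.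
have pc : path (@phi_le n) set0 (rcons c setT).
  rewrite rcons_path phi_le_sub ?subsetT // andbT.
  by case: c sc => //= I c ->; rewrite phi_le_sub ?sub0set.
have [q pq [cq]] := phi_path_refine pc; rewrite last_rcons => lq.
have [T HT] := cover_path_mt pq lq.
exists T; apply/subsetP => I IF; rewrite mem_mt_facet -mem_phi_proper FP //=.
apply/eqP/HT.
have : I \in set0 :: q by apply: cq; rewrite mem_rcons inE mem_sort mem_enum IF orbT.
rewrite inE => /predU1P[I0|//].
by have := FP I IF; rewrite I0 mem_phi_proper cards0.
Qed.

Lemma mem_facets F : (F \in facets K) = (F \in [set mt_facet T | T : MT n]).
Proof.
rewrite inE; apply/maxsetP/imsetP => [[FK maxF] | [T _ ->]].
  have [T FT] := chain_sub_mt_facet FK.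
  by exists T => //; rewrite (maxF _ (mt_facet_chain T) FT).
split=> [|G GK TG]; first exact: mt_facet_chain.
have [S GS] := chain_sub_mt_facet GK; apply/esym/eqP.
by rewrite eqEcard TG (leq_trans (subset_leq_card GS)) // !card_mt_facet.
Qed.

End Poset.

(** * Monotone triangles without movable rows *)

Section WeakOrder.

Variable n : nat.
Implicit Types S T : MT n.

Lemma mt_entry_leq T i k : 0 < k <= i -> i < n ->
  elt (mrow T i.+1) k <= elt (mrow T i) k <= elt (mrow T i.+1) k.+1.
Proof.
case: k => // k /= ki iN; have /interlacesP[_ H] := mt_interlaces T iN.
by apply: H; rewrite mt_card // ltnW.
Qed.

Lemma mt_entry_ltn T i k l : k < l <= i -> i <= n ->
  elt (mrow T i) k < elt (mrow T i) l.
Proof. by move=> /andP[kl li] iN; apply: elt_ltn; rewrite ?mt_card. Qed.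

Lemma times_pi_row T i m : m <= n -> mrow (times_pi T i) m =
  if m == i then hmin (mrow T i.-1) (mrow T i.+1) else mrow T m.
Proof. by move=> mn; rewrite /mrow ffunE inordK. Qed.

Lemma times_pi_entry T i k : 0 < i < n -> k < i ->
  elt (mrow (times_pi T i) i) k.+1 =
  maxn (elt (mrow T i.-1) k) (elt (mrow T i.+1) k.+1).
Proof.
move=> /andP[i0 iN] ki; rewrite times_pi_row ?eqxx; last exact: ltnW.
have cA : #|mrow T i.-1| = i.-1 by rewrite mt_card; lia.
have [] := @elt_image n
  (fun m => maxn (elt (mrow T i.-1) m) (elt (mrow T i.+1) m.+1))
  #|mrow T i.-1|.+1 (hmin (mrow T i.-1) (mrow T i.+1)).
- move=> p q pq; rewrite cA => qi.
  have h1 : elt (mrow T i.-1) p < elt (mrow T i.-1) q by apply: mt_entry_ltn; lia.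
  have h2 : elt (mrow T i.+1) p.+1 < elt (mrow T i.+1) q.+1 by apply: mt_entry_ltn; lia.
  lia.
- move=> p; rewrite cA => pi.
  have h1 : elt (mrow T i.+1) 0 < elt (mrow T i.+1) p.+1 by apply: mt_entry_ltn; lia.
  by have := elt_bound (mrow T i.-1) p; have := elt_bound (mrow T i.+1) p.+1; lia.
- by [].
by move=> _ -> //; rewrite cA prednK.
Qed.

(** Asking this only of the rows where S and T differ makes the condition
    persist when S is pushed towards T, as no new differences can arise. *)
Definition fixed_where_differ S T := forall i, 0 < i < n ->
  mrow S i != mrow T i -> times_pi T i = T.

(** The entry of T at (i, k) is carried unchanged along a straight line, either
    up through (i+1, k), (i+2, k), ... or down through (i-1, k-1),
    (i-2, k-2), ..., to a row that S and T share.  Along either line, read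
    back from that row, the entries of S can only grow. *)
Lemma row_leq S T i k : fixed_where_differ S T -> 0 < k <= i -> i <= n ->
  elt (mrow T i) k <= elt (mrow S i) k.
Proof.
move=> fixT.
have fixedE j l : 0 < j < n -> mrow S j != mrow T j -> l < j ->
    elt (mrow T j) l.+1 = maxn (elt (mrow T j.-1) l) (elt (mrow T j.+1) l.+1).
  by move=> jn dj lj; rewrite -times_pi_entry // fixT.
have agreeN : mrow S n = mrow T n by rewrite !mt_top.
have up d j l : n - j = d -> 0 < l <= j -> j < n ->
    elt (mrow T j) l = elt (mrow T j.+1) l ->
  elt (mrow T j) l <= elt (mrow S j) l.
  elim: d j l => [|d IHd] j l dj lj jn e; first by lia.
  have /andP[Sj _] := mt_entry_leq S lj jn; rewrite e; apply: (leq_trans _ Sj).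
  have [->//|ne] := eqVneq (mrow S j.+1) (mrow T j.+1).
  have jn' : j.+1 < n.
    by rewrite ltn_neqAle jn andbT; apply: contraNneq ne => ->; rewrite agreeN.
  apply: IHd => //; try lia.
  (* A turn down to (j, l-1) is impossible: it would equate two entries of
     row j of T. *)
  case: l lj e {Sj} => // l lj e.
  have := fixedE j.+1 l; rewrite /= ne => /(_ jn' isT) H.
  have h : elt (mrow T j) l < elt (mrow T j) l.+1 by apply: mt_entry_ltn; lia.
  by move: H; rewrite -e; lia.
have down j l : l <= j -> j < n ->
    elt (mrow T j.+1) l.+1 = elt (mrow T j) l ->
  elt (mrow T j.+1) l.+1 <= elt (mrow S j.+1) l.+1.
  elim: j l => [|j IHj] [|l] lj jn e //; rewrite ?e //.
  have lj' : 0 < l.+1 <= j.+1 by [].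
  have /andP[_ Sj] := mt_entry_leq S lj' jn; apply: (leq_trans _ Sj).
  have [->//|ne] := eqVneq (mrow S j.+1) (mrow T j.+1).
  apply: IHj => //; first exact: ltnW.
  (* Likewise, a turn up to (j+2, l+1) would equate two entries of row j+2. *)
  have := fixedE j.+1 l; rewrite /= ne jn => /(_ isT isT lj) H.
  have h : elt (mrow T j.+2) l.+1 < elt (mrow T j.+2) l.+2 by apply: mt_entry_ltn; lia.
  by move: H; rewrite -e; lia.
move=> ki iN.
have [->//|ne] := eqVneq (mrow S i) (mrow T i).
have iN' : i < n.
  by rewrite ltn_neqAle iN andbT; apply: contraNneq ne => ->; rewrite agreeN.
case: i k ki iN iN' ne => [|i] [|k] // ki iN iN' ne.
have := fixedE i.+1 k; rewrite /= iN' => /(_ isT ne ki) H.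
have [e|e] : elt (mrow T i.+1) k.+1 = elt (mrow T i) k \/
  elt (mrow T i.+1) k.+1 = elt (mrow T i.+2) k.+1 by lia.
- by apply: down.
- by apply: (up _ _ _ erefl).
Qed.

Lemma fixed_eq S T : fixed_where_differ S T -> fixed_where_differ T S -> S = T.
Proof.
move=> fT fS; apply: mt_eqP => m mn.
have [m0 mN] : 0 < m /\ m <= n by lia.
apply: elt_inj => [|k]; rewrite !mt_card // => km.
by apply/eqP; rewrite eqn_leq !row_leq.
Qed.

(** The measure that makes the descent from S to T terminate. *)
Definition weight S := \sum_(p : 'I_n.+1 * 'I_n.+1) elt (mrow S p.1) p.2.

Lemma weight_ltn S T :
  (forall i k, 0 < k <= i -> i <= n -> elt (mrow S i) k <= elt (mrow T i) k) ->
  S != T -> weight S < weight T.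
Proof.
move=> leST; have leST' (p : 'I_n.+1 * 'I_n.+1) :
    elt (mrow S p.1) p.2 <= elt (mrow T p.1) p.2.
  have p1n : p.1 <= n by rewrite -ltnS.
  case: (posnP p.2) => [->//|p0]; case: (leqP p.2 p.1) => p12.
    by apply: leST; rewrite ?p0.
  by rewrite /elt nth_default //= size_map -cardE mt_card.
rewrite ltn_neqAle leq_sum ?andbT => [|p _]; last exact: leST'.
apply: contraNneq => eW.
have [_] := @leqif_sum _ predT _ _ _ (fun p _ => leqif_eq (leST' p)).
rewrite -/(weight S) -/(weight T) eW eqxx => /esym/forallP eST.
apply/eqP/mt_eqP => m mn; have [mn' mN] : m <= n /\ m < n.+1 by lia.
apply: elt_inj => [|k]; rewrite !mt_card // => km.
have kN : k.+1 < n.+1 by lia.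
exact/eqP/(eST (Ordinal mN, Ordinal kN)).
Qed.

Definition mt_times_pi S i (hi : 0 < i < n) : MT n :=
  MkMT (is_mt_times_pi hi (mt_rowsP S)).

Lemma times_pi_leq S i j k : 0 < i < n -> 0 < k <= j -> j <= n ->
  elt (mrow (times_pi S i) j) k <= elt (mrow S j) k.
Proof.
move=> iN kj jn; have [eji|ji] := eqVneq j i; last first.
  by rewrite times_pi_row // (negbTE ji).
case: k kj => // k kj; rewrite eji times_pi_entry //; last lia.
have /andP[h1 _] := @mt_entry_leq S i k.+1 ltac:(lia) ltac:(lia).
rewrite geq_max h1 andbT; case: k {h1} kj => // k kj.
case: i iN eji => // i iN eji.
by have /andP[_] := @mt_entry_leq S i k.+1 ltac:(lia) ltac:(lia).
Qed.

(** As long as S differs from T, uniqueness provides a row of S to push down in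
    which they differ. *)
Lemma fixed_weak_le S T : fixed_where_differ S T -> weak_le T S.
Proof.
have [w] := ubnP (weight S); elim: w S => // w IHw S Sw fT.
have [->|neST] := eqVneq S T; first exact: connect0.
have [/forall_inP fS|] := boolP [forall (i : 'I_n | (0 < i) && (mrow S i != mrow T i)),
    times_pi S i == S].
  case/eqP: neST; apply: fixed_eq => // i /andP[i0 iN] ne.
  by apply/eqP/(fS (Ordinal iN)); rewrite i0 eq_sym.
rewrite negb_forall_in => /exists_inP[i /andP[i0 di] ne].
have iN : 0 < i < n by rewrite i0 ltn_ord.
pose R := mt_times_pi S iN.
have RS : weak_le R S by apply/connect1/existsP; exists i; rewrite i0 eqxx.
apply: connect_trans RS; apply: IHw.
  apply: (@leq_trans (weight S)); last by rewrite -ltnS.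
  by apply: weight_ltn => [j k|]; [apply: times_pi_leq | rewrite -val_eqE].
move=> j jN; rewrite times_pi_row; last lia.
by case: (j =P i) => [->|_] dj; apply: fT; rewrite // i0 ltn_ord.
Qed.

(** The contrapositive of fixed_weak_le, in the form that shelling needs. *)
Lemma exists_movable_row S T : ~~ weak_le T S ->
  exists i, [/\ 0 < i < n, mrow S i != mrow T i & times_pi T i != T].
Proof.
move=> nTS.
have [/existsP[i /and3P[i0 di mi]]|noi] := boolP [exists i : 'I_n,
    [&& 0 < i, mrow S i != mrow T i & times_pi T i != T]].
  by exists i; rewrite i0 ltn_ord.
case/negP: nTS; apply: fixed_weak_le => i /andP[i0 iN] di.
by apply: contraNeq noi => mi; apply/existsP; exists (Ordinal iN); rewrite i0 di.
Qed.

Lemma times_pi_facetI T i (hi : 0 < i < n) : times_pi T i != T ->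
  mt_facet (mt_times_pi T hi) :&: mt_facet T = mt_facet T :\ mrow T i.
Proof.
move=> mi; apply/setP => I; rewrite in_setI in_setD1 andbC [RHS]andbC.
apply: andb_id2l => /mt_facetP[m mn ->].
have [mN iN] : m <= n /\ i <= n by lia.
rewrite mem_mt_facet mt_card // mn /= times_pi_row //.
case: (eqVneq m i) => [emi|ne]; last first.
  rewrite eqxx; apply/esym; apply: contra_neq ne => /(congr1 (fun I : {set _} => #|I|)).
  by rewrite !mt_card.
rewrite emi eqxx; apply: contraNF mi => /eqP e.
suff /(congr1 (@mt_rows n)) /= -> : mt_times_pi T hi = T by [].
apply: mt_eqP => j jn; rewrite times_pi_row; last lia.
by case: (eqVneq j i) => [->|//]; rewrite -e.
Qed.

End WeakOrder.

(** * Shelling *)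

Theorem theorem1p1 (n : nat) (hn : 1 <= n) (s : seq (MT n))
    (hs : linear_extension (@weak_lt n) s) :
  shelling_order (order_complex (@phi_le n) (phi_proper n))
                 [seq mt_facet T | T <- s].
Proof.
have [ps lts] := hs.
have us : uniq s by rewrite (perm_uniq ps) enum_uniq.
have ins T : T \in s by rewrite (perm_mem ps) mem_enum.
split.
- move=> F G; rewrite !mem_facets => /imsetP[S _ ->] /imsetP[T _ ->].
  by rewrite !card_mt_facet.
- apply: uniq_perm; rewrite ?enum_uniq ?(map_inj_uniq (@mt_facet_inj n)) // => F.
  rewrite mem_enum mem_facets.
  by apply/mapP/imsetP => -[T _ ->]; exists T.
move=> i j ij; rewrite size_map => js.
have T0 : MT n by case: s js {hs ps lts us ins}.
have is' := ltn_trans ij js.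
set S := nth T0 s i; set T := nth T0 s j.
have nTS : ~~ weak_le T S.
  apply/negP => TS; have := lts T S; rewrite /weak_lt TS andbT.
  have neTS : T != S by rewrite nth_uniq //; lia.
  by move=> /(_ neTS); rewrite !index_uniq //; lia.
have [r [rn dr mr]] := exists_movable_row nTS.
pose R := mt_times_pi T rn.
exists (index R s).
have RT : index R s < j.
  rewrite -(index_uniq T0 js us); apply: lts; rewrite /weak_lt mr /=.
  have /andP[r0 rN] := rn.
  by apply/connect1/existsP; exists (Ordinal rN); rewrite r0 eqxx.
rewrite !(nth_map T0) ?index_mem // nth_index // -/S -/T times_pi_facetI //.
split=> //; last first.
  rewrite [RHS](cardsD1 (mrow T r)).
  suff -> : mrow T r \in mt_facet T by [].
  by apply/mt_facetP; exists r.
apply/subsetP => I; rewrite in_setI in_setD1 => /andP[IS IT]; rewrite IT andbT.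
apply: contraNneq dr => eI; move: IS; rewrite eI mem_mt_facet mt_card; last lia.
by rewrite eq_sym => /andP[_].
Qed.
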